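(* Let $s\ge 0$ be an integer and let $P$ be a class-$s$ 0-1 matrix with at least one 1-entry. Then \[ \mathrm{ex}(n,P)\le n\,2^{O\left(\log^{\frac{s}{s+1}} n\right)}, \] where the implied constant depends only on $P$.
   Context: $\log$ is the binary logarithm. A 0-1 matrix $A$ contains a 0-1 matrix $B$ if $B$ can be obtained from $A$ by deleting some rows, some columns, and changing some 1-entries to 0-entries. For a 0-1 matrix $P$ with at least one 1-entry, $\mathrm{ex}(n,P)$ is the maximum number of 1-entries in an $n\times n$ 0-1 matrix that does not contain $P$. An $l\times k$ 0-1 matrix $P$ is split by a vertical separation at $a\in[l-1]$ into its first $a$ rows and its last $l-a$ rows if for all but at most one column $y$, either $P(x,y)=0$ for all $x\le a$ or $P(x,y)=0$ for all $x>a$. A 0-1 matrix is class-$0$ if it has a single row; for $s>0$ it is class-$s$ if it has a single row or it can be partitioned by a vertical separation into two class-$(s-1)$ matrices. *)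

(* Defs.v *)
From mathcomp Require Import all_boot all_order all_algebra.
From mathcomp Require Import all_classical all_reals all_analysis.

Set Implicit Arguments.
Unset Strict Implicit.
Unset Printing Implicit Defensive.

Import Order.TTheory GRing.Theory Num.Theory.

(* 0-1 matrices are represented as boolean matrices. *)

(* The strictly increasing maps [f] and [g] select the rows and columns of [A]
   that are kept; the implication allows 1-entries to be turned into 0. *)
Definition contains (m n l k : nat) (A : 'M[bool]_(m, n)) (B : 'M[bool]_(l, k))
    : Prop :=
  exists (f : 'I_l -> 'I_m) (g : 'I_k -> 'I_n),
    [/\ forall i i' : 'I_l, (i < i')%N -> (f i < f i')%N,
        forall j j' : 'I_k, (j < j')%N -> (g j < g j')%N &
        forall (i : 'I_l) (j : 'I_k), B i j -> A (f i) (g j)].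

Definition weight (m n : nat) (A : 'M[bool]_(m, n)) : nat :=
  #|[set ij : 'I_m * 'I_n | A ij.1 ij.2]|.

(* If [P] has no 1-entry the range of the maximum can be empty, and the
   maximum is then 0. *)
Definition ex (n l k : nat) (P : 'M[bool]_(l, k)) : nat :=
  \max_(A : 'M[bool]_n | ~~ `[< contains A P >]) weight A.

(* [P] has [l = a + b] rows; the positivity conditions say that the separation
   lies at some [a] with 1 <= a <= l - 1. *)
Definition vertical_separation (a b k : nat) (P : 'M[bool]_(a + b, k)) : Prop :=
  [/\ (0 < a)%N, (0 < b)%N &
      (#|[set y : 'I_k | ~~ ([forall x, ~~ usubmx P x y]
                             || [forall x, ~~ dsubmx P x y])]| <= 1)%N].

Inductive is_class (k : nat) :
    nat -> forall l : nat, 'M[bool]_(l, k) -> Prop :=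
| class_single_row (s : nat) (P : 'M[bool]_(1, k)) : is_class s P
| class_split (s a b : nat) (P : 'M[bool]_(a + b, k)) :
    vertical_separation P ->
    is_class s (usubmx P) -> is_class s (dsubmx P) -> is_class s.+1 P.

Definition log2 (R : realType) (x : R) : R := (ln x / ln 2)%R.

(* Main.v *)
(** A row spans a [k]-tuple [T] of column blocks if it has an entry in each of
them. Let a matrix avoid the class-[s] pattern [P], and cut its columns into [m]
blocks. If no row meets [k] blocks, the blocks can be treated separately at the
price of a factor [k]. To reach this situation, first keep only entries that see
their own column in the same way at [s - 1] nested vertical dyadic scales (this
costs a factor [(log n) ^ (s - 1)]), and then discard, [l] times over, for every
[T], every column and every scale, the first and the last group of the column that
meets a row spanning [T] (this costs O([m ^ k polylog n]) entries per column and
half of the rest). If a row of the remaining matrix still spanned some [T], then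
[P] could be embedded with its [i]-th column in the [i]-th block of [T]: the two
halves of a class-[i] matrix are placed in different groups of scale [i - 1] inside
one group of scale [i], joined through their common column. All other columns of
the two halves lie in different blocks and are therefore automatically in the
right order. Iterating [z] times with [m = 2 ^ z ^ s], where [z ^ s.+1] is about
[log n], gives the bound. *)

Require Import Defs.
From mathcomp Require Import all_boot all_order all_algebra zify.

Set Implicit Arguments.
Unset Strict Implicit.
Unset Printing Implicit Defensive.

(** * Counting through fibers, and increasing selections from a set of ordinals *)

Lemma card_fibers (S I : finType) (f : S -> I) (A : {set S}) :
  #|A| = \sum_y #|[set x in A | f x == y]|.
Proof.
rewrite -sum1_card (partition_big f predT) //=.
by apply: eq_bigr => y _; rewrite sum1dep_card; apply: eq_card => x; rewrite !inE.
Qed.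

Lemma leq_card_fibers (S I : finType) (f : S -> I) (A : {set S}) (d : nat) :
  (forall y, #|[set x in A | f x == y]| <= d) -> #|A| <= #|f @: A| * d.
Proof.
move=> fib; rewrite -sum1_card (partition_big_imset f) /= -sum_nat_const.
apply: leq_sum => y _; apply: leq_trans (fib y).
by rewrite sum1dep_card; apply: subset_leq_card; apply/subsetP=> x; rewrite !inE.
Qed.

Lemma geq_card_fibers (S I : finType) (f : S -> I) (A : {set S}) (B : {set I})
    (d : nat) :
  (forall y, y \in B -> d <= #|[set x in A | f x == y]|) -> #|B| * d <= #|A|.
Proof.
move=> fib; rewrite -sum_nat_const.
apply: (@leq_trans (\sum_(y in B) #|[set x in A | f x == y]|)).
  exact: leq_sum.
rewrite (card_fibers f).
by rewrite [X in _ <= X](bigID (mem B)) /= leq_addr.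
Qed.

Lemma exists_increasing_ffun (m k : nat) (B : {set 'I_m}) :
  k <= #|B| -> exists T : {ffun 'I_k -> 'I_m},
    (forall i j : 'I_k, i < j -> T i < T j) /\ (forall i, T i \in B).
Proof.
case: k => [|k] kB.
  by exists [ffun i : 'I_0 => match notF (ltn_ord i) with end]; split; case.
have [x0 x0B] : exists x, x \in B by apply/card_gt0P; lia.
have szB : size (enum B) = #|B| by rewrite -cardE.
have srt : sorted ltn (map val (enum B)).
  rewrite (subseq_sorted ltn_trans (s2 := map val (enum 'I_m))) //.
    apply: map_subseq; have -> : enum B = filter (mem B) (enum 'I_m) by rewrite enumT.
    exact: filter_subseq.
  by rewrite val_enum_ord iota_ltn_sorted.
exists [ffun i : 'I_k.+1 => nth x0 (enum B) i]; split=> [i j ij|i]; rewrite !ffunE.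
  have /(_ i j) := sorted_ltn_nth ltn_trans 0 srt.
  rewrite !inE size_map szB !(leq_trans (ltn_ord _) kB) => /(_ isT isT ij).
  by rewrite !(nth_map x0) ?szB // (leq_trans (ltn_ord _) kB).
by rewrite -mem_enum mem_nth // szB (leq_trans (ltn_ord i) kB).
Qed.

Lemma leq_card_bigcup (I S : finType) (F : I -> {set S}) :
  #|\bigcup_i F i| <= \sum_i #|F i|.
Proof.
elim/big_rec2: _ => [|i d A _ le_d]; first by rewrite cards0.
by apply: leq_trans (leq_card_setU _ _).1 _; rewrite leq_add2l.
Qed.

(** * Homogenizing the vertical scales *)

Definition cols (n : nat) (E : {set 'I_n * 'I_n}) : nat := #|snd @: E|.
Definition rows (n : nat) (E : {set 'I_n * 'I_n}) : nat := #|fst @: E|.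

(* The rows are grouped into dyadic intervals of length [2 ^ u]; a [u]-cell is
   the part of one column lying in one such interval. *)
Definition grp (n u : nat) (r : 'I_n) : 'I_n :=
  Ordinal (leq_ltn_trans (leq_div r (2 ^ u)) (ltn_ord r)).

Definition cell (n u : nat) (e : 'I_n * 'I_n) : 'I_n * 'I_n :=
  (grp u e.1, e.2).

Lemma grp_mono (n u v : nat) (r r' : 'I_n) :
  u <= v -> grp u r = grp u r' -> grp v r = grp v r'.
Proof.
move=> uv [] /= h; apply: val_inj => /=.
by rewrite -(subnKC uv) expnD !divnMA h.
Qed.

Lemma grp_lt (n u : nat) (r r' : 'I_n) : grp u r < grp u r' -> r < r'.
Proof.
by move=> /= h; rewrite ltnNge; apply: contraL h => h; rewrite -leqNgt leq_div2r.
Qed.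

Lemma grp_large (n L u : nat) (r r' : 'I_n) :
  n <= 2 ^ L -> L <= u -> grp u r = grp u r'.
Proof.
move=> nL Lu; apply: val_inj => /=.
have le2 : 2 ^ L <= 2 ^ u by rewrite leq_exp2l.
by rewrite !divn_small //; apply: leq_trans (ltn_ord _) (leq_trans nL le2).
Qed.

Lemma card_cell_large (n L u : nat) (E : {set 'I_n * 'I_n}) :
  n <= 2 ^ L -> L <= u -> #|cell u @: E| <= cols E.
Proof.
move=> nL Lu; have inj : {in cell u @: E &, injective snd}.
  move=> _ _ /imsetP[[r c] _ ->] /imsetP[[r' c'] _ ->] /= <-.
  by rewrite /cell /= (grp_large r r' nL Lu).
by rewrite -(card_in_imset inj) -imset_comp.
Qed.

(* Each entry is assigned the least scale at which its cell contains [q] entries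
   of [E]; [F] is the most popular of these classes. *)
Lemma refine_scale (n : nat) (E : {set 'I_n * 'I_n}) (L q v : nat) :
  n <= 2 ^ L -> (forall y, #|[set e in E | cell v e == y]| <= 2 * q) ->
  exists u (F : {set 'I_n * 'I_n}), [/\ v <= u, F \subset E,
    forall y, #|[set e in F | cell u e == y]| <= 2 * q,
    #|cell u @: F| * q <= #|E| & #|E| <= q * cols E + L.+1 * #|F|].
Proof.
move=> nL smallv.
pose light u (e : 'I_n * 'I_n) := #|[set x in E | cell u x == cell u e]| < q.
pose S i := [set e in E | ~~ light (v + i) e
                & [forall i' : 'I_i, light (v + i') e]].
have [i0 maxS] : exists i0 : 'I_L.+1, forall i : 'I_L.+1, #|S i| <= #|S i0|.
  have [i0 eq0] := @eq_bigmax 'I_L.+1 (fun i => #|S (val i)|)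
    ltac:(by rewrite card_ord).
  by exists i0 => i; rewrite -eq0; apply: (leq_bigmax (F := fun i : 'I__ => #|S i|)).
exists (v + i0), (S i0); split.
- exact: leq_addr.
- by apply/subsetP=> e; rewrite inE => /andP[].
- move=> y; case: (posnP i0) => [i00|i0_gt0].
    apply: leq_trans (smallv y); apply: subset_leq_card; apply/subsetP=> e.
    by rewrite !inE i00 addn0 => /andP[/andP[-> _] ->].
  pose w := v + i0.-1.
  have wS : v + i0 = w.+1 by rewrite /w; lia.
  (* A cell of scale [w.+1] consists of two cells of scale [w], told apart by the parity of the
     group. An entry of [S i0] is still light at scale [w], so each of the two contributes at most
     [q]. *)
  have half b : #|[set e in S i0 | cell (v + i0) e == y & odd (grp w e.1) == b]| <= q.
    set H := [set e in S i0 | _].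
    case: (set_0Vmem H) => [->|[e]]; first by rewrite cards0.
    rewrite inE => /and3P[eS /eqP ey /eqP eb].
    have /ltnW : light w e.
      move: eS; rewrite inE => /and3P[_ _ /forallP].
      by move=> /(_ (Ordinal (ltac:(lia) : i0.-1 < i0))).
    apply: leq_trans; apply: subset_leq_card; apply/subsetP=> e'.
    rewrite !inE => /and3P[/and3P[-> _ _] /eqP e'y /eqP e'b] /=.
    move: e'y; rewrite -ey wS => -[] h e2; apply/eqP; rewrite /cell e2.
    congr pair; apply: val_inj => /=; move: h eb e'b => /=.
    rewrite !expnSr !divnMA !divn2 => h eb e'b.
    by rewrite -[LHS]odd_double_half -[RHS]odd_double_half h eb e'b.
  rewrite mul2n -addnn; apply: leq_trans (leq_add (half true) (half false)).
  apply: leq_trans (leq_card_setU _ _).1; apply: subset_leq_card; apply/subsetP=> e.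
  by rewrite !inE => /andP[-> ->] /=; case: odd.
- apply: (geq_card_fibers (f := cell (v + i0))) => y /imsetP[e eS ->].
  by move: eS; rewrite inE => /and3P[_ + _]; rewrite -leqNgt.
(* The entries that never become heavy: at scale [v + L] a cell is a whole column, so at most [q] of
   them lie in each column. *)
- pose Z := [set e in E | light (v + L) e].
  have cover : E \subset Z :|: \bigcup_(i < L.+1) S i.
    apply/subsetP=> e eE; rewrite !inE eE /=; case: (boolP (light _ _)) => //= nl.
    have ex_i : exists i, ~~ light (v + i) e by exists L.
    case: (ex_minnP ex_i) => i nli mini.
    have iL : i < L.+1 by rewrite ltnS mini.
    apply/bigcupP; exists (Ordinal iL) => //=; rewrite inE eE nli /=.
    by apply/forallP=> i'; apply: contraTT (ltn_ord i') => /mini; rewrite -leqNgt.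
  apply: leq_trans (subset_leq_card cover) _.
  apply: leq_trans (leq_card_setU _ _).1 _; apply: leq_add.
    have ZE : Z \subset E by apply/subsetP=> e; rewrite inE => /andP[].
    rewrite mulnC.
    apply: leq_trans (leq_mul (subset_leq_card (imsetS snd ZE)) (leqnn q)).
    apply: leq_card_fibers => c; set H := [set e in Z | _].
    case: (set_0Vmem H) => [->|[e]]; first by rewrite cards0.
    rewrite !inE => /andP[/andP[eE el] /eqP ec]; apply: leq_trans (ltnW el).
    apply: subset_leq_card; apply/subsetP=> e'; rewrite !inE.
    move=> /andP[/andP[-> _] /eqP e'c] /=; apply/eqP.
    by rewrite /cell ec e'c (grp_large e'.1 e.1 nL) // leq_addl.
  apply: leq_trans (leq_card_bigcup _) _.
  apply: (@leq_trans (\sum_(i < L.+1) #|S i0|)); first exact: leq_sum.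
  by rewrite sum_nat_const card_ord.
Qed.

(** Iterates [refine_scale] with [q = (2 * K) ^ j.+1]. The ratio [2 * K] between consecutive scales
    is what makes pruning cheap: removing one [u j]-cell from every [u j.+1]-cell deletes at most
    [#|E| / K] entries when [j < i]. *)
Lemma homogenize (n : nat) (E : {set 'I_n * 'I_n}) (L K i : nat) :
  n <= 2 ^ L -> 0 < K ->
  exists (u : nat -> nat) (F : {set 'I_n * 'I_n}),
    [/\ F \subset E,
        forall j, u j <= u j.+1,
        forall j y, j <= i -> #|[set e in F | cell (u j) e == y]| <= 2 * (2 * K) ^ j,
        forall j, j < i -> #|cell (u j.+1) @: F| * (2 * K) ^ j.+1 <= #|E| &
        #|E| <= i * (2 * K * L.+1) ^ i * cols E + L.+1 ^ i * #|F|].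
Proof.
move=> nL K0; elim: i => [|i [u [F [FE umono small cells cardE]]]].
  exists (fun=> 0), E; split=> //; last by rewrite mul0n add0n mul1n.
  move=> j y; rewrite leqn0 => /eqP ->; rewrite muln1.
  apply: leq_trans (isT : 1 <= 2); apply/card_le1_eqP=> -[r c] [r' c'].
  rewrite !inE => /andP[_ /eqP <-] /andP[_ /eqP []] /=.
  by rewrite !divn1 => h <-; congr pair; apply: val_inj.
have small_i y : #|[set e in F | cell (u i) e == y]| <= 2 * (2 * K) ^ i.+1.
  by apply: leq_trans (small i y (leqnn i)) _; rewrite leq_mul2l /= leq_exp2l; lia.
have [w [G [uw GF smallw cellsw cardF]]] := refine_scale nL small_i.
exists (fun j => if j <= i then u j else w), G; split.
- exact: subset_trans GF FE.
- move=> j; case: (ltngtP j i) => [ji|ij|->].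
  + exact: umono.
  + by [].
  + by [].
- move=> j y; rewrite leq_eqVlt => /predU1P[->|]; first by rewrite ltnn.
  rewrite ltnS => ji; rewrite ji; apply: leq_trans (small j y ji).
  apply: subset_leq_card; apply/subsetP=> e; rewrite !inE => /andP[eG ->].
  by rewrite (subsetP GF).
- move=> j; rewrite ltnS leq_eqVlt => /predU1P[->|ji].
    by rewrite ltnn; apply: leq_trans cellsw (subset_leq_card FE).
  rewrite ji; apply: leq_trans (cells j ji).
  by rewrite leq_mul2r subset_leq_card ?orbT // imsetS.
- apply: leq_trans cardE _.
  have colsF : cols F <= cols E by rewrite subset_leq_card // imsetS.
  have : #|F| <= (2 * K) ^ i.+1 * cols E + L.+1 * #|G|.
    by apply: leq_trans cardF _; rewrite leq_add2r leq_mul2l colsF orbT.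
  rewrite -(leq_pmul2l (expn_gt0 L.+1 i)) => cardF'.
  apply: leq_trans (leq_add (leqnn _) cardF') _.
  rewrite [L.+1 ^ i.+1]expnS mulnDr addnA mulnA [L.+1 ^ i * (_ * _)]mulnCA mulnA.
  rewrite leq_add2r -mulnDl leq_mul2r; apply/orP; right.
  rewrite (mulSnr i); apply: leq_add.
    by rewrite leq_mul // leq_pexp2l //; lia.
  by rewrite [leqRHS]expnMn [leqRHS]mulnC leq_mul // leq_pexp2l.
Qed.

(** * Pruning and embedding *)

Section Pruning.

Variables (n m k : nat) (blk : 'I_n -> 'I_m) (u : nat -> nat).
Implicit Types (E F : {set 'I_n * 'I_n}) (T : {ffun 'I_k -> 'I_m}).

Definition spans E (r : 'I_n) T : bool :=
  [forall x, [exists c, ((r, c) \in E) && (blk c == T x)]].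

Lemma spansS E F r T : E \subset F -> spans E r T -> spans F r T.
Proof.
move=> EF /forallP sp; apply/forallP=> x; have /existsP[c /andP[rc cx]] := sp x.
by apply/existsP; exists c; rewrite (subsetP EF).
Qed.

(* With [R := ltn] (resp. [gtn]): the entries lying in the first (resp. last)
   [u j]-cell, within their [u j.+1]-cell, that meets a row spanning [T]. *)
Definition extreme (R : rel nat) E T j : {set 'I_n * 'I_n} :=
  [set e in E | spans E e.1 T &&
    [forall e', [&& e' \in E, spans E e'.1 T & cell (u j.+1) e' == cell (u j.+1) e]
                ==> ~~ R (grp (u j) e'.1) (grp (u j) e.1)]].

(** Two extreme entries of one [u j.+1]-cell cannot precede each other under [R], so totality puts
    them into the same [u j]-cell. *)
Lemma card_extreme (R : rel nat) E T j d :
  (forall a b, a != b -> R a b || R b a) ->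
  (forall y, #|[set e in E | cell (u j) e == y]| <= d) ->
  #|extreme R E T j| <= #|cell (u j.+1) @: E| * d.
Proof.
move=> Rtot small; set X := extreme _ _ _ _.
have XE : X \subset E by apply/subsetP=> e; rewrite inE => /andP[].
apply: (@leq_trans (#|cell (u j.+1) @: X| * d)); last first.
  by rewrite leq_mul2r subset_leq_card ?orbT // imsetS.
apply: leq_card_fibers => y; set H := [set e in X | _].
case: (set_0Vmem H) => [->|[e]]; first by rewrite cards0.
rewrite !inE => /andP[/and3P[eE esp /forallP emin] /eqP ey].
apply: leq_trans (small (cell (u j) e)); apply: subset_leq_card.
apply/subsetP=> e'; rewrite !inE => /andP[/and3P[e'E e'sp /forallP e'min] /eqP e'y].
have e2 : e'.2 = e.2 by have := congr1 snd e'y; rewrite -ey.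
rewrite e'E /= /cell e2; apply/eqP; congr pair; apply: val_inj; apply/eqP.
apply: contraT => /Rtot.
have := emin e'; rewrite e'E e'sp e'y ey eqxx /= => /negbTE ->.
by have := e'min e; rewrite eE esp e'y ey eqxx /= => /negbTE ->.
Qed.

Lemma notin_extreme (R : rel nat) E T j (e : 'I_n * 'I_n) :
  e \in E -> spans E e.1 T -> e \notin extreme R E T j ->
  exists r, [/\ (r, e.2) \in E, spans E r T,
    grp (u j.+1) r = grp (u j.+1) e.1 & R (grp (u j) r) (grp (u j) e.1)].
Proof.
move=> eE sp; rewrite inE eE sp /= negb_forall => /existsP[[r c]].
rewrite negb_imply negbK => /andP[/and3P[rE rsp /eqP[rg cc]] Rr].
by exists r; split=> //; [rewrite -cc | apply: val_inj].
Qed.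

Variable s : nat.

Definition prune E : {set 'I_n * 'I_n} :=
  E :\: \bigcup_T \bigcup_(j < s) (extreme ltn E T j :|: extreme gtn E T j).

Definition chain E a : {set 'I_n * 'I_n} := iter a prune E.

Lemma chainS E a b : a <= b -> chain E b \subset chain E a.
Proof.
move/subnK <-; elim: (b - a) => [|d IHd] //.
by rewrite addSn; apply: subset_trans (subsetDl _ _) IHd.
Qed.

Lemma prune_between E T (j : 'I_s) (r c : 'I_n) :
  (r, c) \in prune E -> spans E r T ->
  (exists r', [/\ (r', c) \in E, spans E r' T,
     grp (u j.+1) r' = grp (u j.+1) r & grp (u j) r' < grp (u j) r]) /\
  (exists r', [/\ (r', c) \in E, spans E r' T,
     grp (u j.+1) r' = grp (u j.+1) r & grp (u j) r < grp (u j) r']).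
Proof.
rewrite inE => /andP[nX rcE] sp.
have {nX} : (r, c) \notin extreme ltn E T j :|: extreme gtn E T j.
  apply: contra nX => rcX; apply/bigcupP; exists T => //.
  by apply/bigcupP; exists j.
rewrite inE negb_or => /andP[n1 n2]; split.
- exact: (notin_extreme rcE sp n1).
- exact: (notin_extreme rcE sp n2).
Qed.

(** The loss is measured by the cells of the larger set [E], so that one bound serves every round in
    [card_chain]. The factor 2 accounts for the first and the last cell, [m ^ k] for the tuples
    [T]. *)
Lemma card_prune E F (d : nat -> nat) :
  F \subset E ->
  (forall j y, j < s -> #|[set e in E | cell (u j) e == y]| <= d j) ->
  #|F| <= #|prune F| + m ^ k * \sum_(j < s) 2 * (#|cell (u j.+1) @: E| * d j).
Proof.
move=> FE small; rewrite -[X in X <= _](cardsID (F :\: prune F)).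
rewrite [X in X <= _]addnC; apply: leq_add.
  apply: subset_leq_card; apply/subsetP=> e; rewrite !inE.
  by case: (e \in F); rewrite ?andbF //= !andbT negbK.
apply: (@leq_trans
    #|\bigcup_T \bigcup_(j < s) (extreme ltn F T j :|: extreme gtn F T j)|).
  apply: subset_leq_card; apply/subsetP=> e; rewrite !inE.
  by case: (e \in F) => //=; rewrite ?andbT ?negbK.
apply: leq_trans (leq_card_bigcup _) _.
have -> : m ^ k = #|{ffun 'I_k -> 'I_m}| by rewrite card_ffun !card_ord.
rewrite -sum_nat_const; apply: leq_sum => T _.
apply: leq_trans (leq_card_bigcup _) _; apply: leq_sum => j _.
apply: leq_trans (leq_card_setU _ _).1 _; rewrite mul2n -addnn.
have smallF y : #|[set e in F | cell (u j) e == y]| <= d j.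
  apply: leq_trans (small j y (ltn_ord j)); apply: subset_leq_card.
  by apply/subsetP=> e; rewrite !inE => /andP[/(subsetP FE) -> ->].
have le_cells : #|cell (u j.+1) @: F| * d j <= #|cell (u j.+1) @: E| * d j.
  by rewrite leq_mul2r subset_leq_card ?orbT // imsetS.
by apply: leq_add; apply: leq_trans le_cells; apply: card_extreme => // a b;
  rewrite neq_ltn // orbC.
Qed.

Lemma card_chain E (d : nat -> nat) a :
  (forall j y, j < s -> #|[set e in E | cell (u j) e == y]| <= d j) ->
  #|E| <= #|chain E a| + a * (m ^ k * \sum_(j < s) 2 * (#|cell (u j.+1) @: E| * d j)).
Proof.
move=> small; elim: a => [|a IHa]; first by rewrite addn0.
apply: leq_trans IHa _; rewrite mulSn addnA leq_add2r.
exact: card_prune (chainS _ (leq0n a)) small.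
Qed.

Hypothesis umono : forall j, u j <= u j.+1.

(* The clause on [r'] lets a copy be extended through any of its columns, even
   through those where [P] has no 1-entry. *)
Definition copy E T (v : nat) (r : 'I_n) (l : nat) (P : 'M[bool]_(l, k))
    (f : 'I_l -> 'I_n) (g : 'I_k -> 'I_n) : Prop :=
  [/\ forall i i' : 'I_l, i < i' -> f i < f i',
      forall i, grp v (f i) = grp v r,
      forall x, blk (g x) = T x /\
        exists r', [/\ grp v r' = grp v r, (r', g x) \in E & spans E r' T] &
      forall i x, P i x -> (f i, g x) \in E].

Lemma copyS E F T v r l (P : 'M[bool]_(l, k)) f g :
  E \subset F -> copy E T v r P f g -> copy F T v r P f g.
Proof.
move=> EF [finc fgrp gsup fg]; split=> //.
  move=> x; have [gx [r' [rr' r'E sp]]] := gsup x; split=> //; exists r'.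
  by split; rewrite ?(subsetP EF) // (spansS EF).
by move=> i x /fg; apply: (subsetP EF).
Qed.

(** The given column [y] is the value of [y0] when no column has 1-entries in both halves. *)
Lemma separationP a b (P : 'M[bool]_(a + b, k)) (y : 'I_k) :
  vertical_separation P -> exists y0 : 'I_k, forall x, x != y0 ->
    (forall i, ~~ usubmx P i x) \/ (forall i, ~~ dsubmx P i x).
Proof.
case=> _ _; set D := [set _ | _] => cardD.
have [y0 Dy0] : exists y0, D \subset [set y0].
  by case: (set_0Vmem D) => [->|[y0 y0D]]; [exists y; apply: sub0set |
    exists y0; apply/subsetP=> x xD; rewrite inE; apply/eqP;
    apply: (card_le1_eqP cardD)].
exists y0 => x xy0; have : x \notin D.
  by apply: contra xy0 => /(subsetP Dy0); rewrite inE.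
by rewrite inE negbK => /orP[] /forallP; [left | right].
Qed.

(** The rows are in order because the [v]-group of [r0] precedes that of [r1]. Each column follows
    the half in which it has 1-entries, and the two halves agree at [y0]. The last two clauses
    record which half determines the image of [y], so that a prescribed column is kept. *)
Lemma merge_copies E T v w r0 r1 r a b (P : 'M[bool]_(a + b, k)) f0 g0 f1 g1 y0 :
  v <= w -> grp w r0 = grp w r -> grp w r1 = grp w r -> grp v r0 < grp v r1 ->
  copy E T v r0 (usubmx P) f0 g0 -> copy E T v r1 (dsubmx P) f1 g1 ->
  g0 y0 = g1 y0 ->
  (forall x, x != y0 -> (forall i, ~~ usubmx P i x) \/ (forall i, ~~ dsubmx P i x)) ->
  forall y, exists f g, copy E T w r P f g /\
    (((y == y0) || [forall i, ~~ dsubmx P i y] -> g y = g0 y) /\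
     ((y == y0) || [exists i, dsubmx P i y] -> g y = g1 y)).
Proof.
move=> vw r0r r1r r01 [f0inc f0grp g0sup f0g0] [f1inc f1grp g1sup f1g1] g01 sep y.
pose f i := match split i with inl i0 => f0 i0 | inr i1 => f1 i1 end.
pose g x := if [exists i, dsubmx P i x] then g1 x else g0 x.
have f01 i0 i1 : f0 i0 < f1 i1.
  by apply: (@grp_lt _ v); rewrite f0grp f1grp.
have fl i0 : f (lshift b i0) = f0 i0 by rewrite /f (unsplitK (inl i0)).
have fr i1 : f (rshift a i1) = f1 i1 by rewrite /f (unsplitK (inr i1)).
exists f, g; split; last first.
  split; rewrite /g.
    case/orP=> [/eqP->|/forallP dn0]; first by rewrite g01 if_same.
    by case: existsP => // -[i]; rewrite (negbTE (dn0 i)).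
  by case/orP=> [/eqP->|->] //; rewrite g01 if_same.
split.
- move=> i i'; case: (split_ordP i) => i0 ->; case: (split_ordP i') => i0' ->.
  + by rewrite !fl; apply: f0inc.
  + by rewrite fl fr.
  + by rewrite /= => h; have := ltn_ord i0'; lia.
  + by rewrite !fr /= ltn_add2l; apply: f1inc.
- move=> i; case: (split_ordP i) => i0 ->.
  + by rewrite fl -r0r; apply: grp_mono vw _.
  + by rewrite fr -r1r; apply: grp_mono vw _.
- move=> x; rewrite /g; case: ifP => _.
  + have [gx [r' [rr' r'E sp]]] := g1sup x; split=> //; exists r'; split=> //.
    by rewrite -r1r; apply: grp_mono vw _.
  + have [gx [r' [rr' r'E sp]]] := g0sup x; split=> //; exists r'; split=> //.
    by rewrite -r0r; apply: grp_mono vw _.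
- move=> i x; case: (split_ordP i) => i0 -> Pix; rewrite /g.
  + have uPix : usubmx P i0 x by rewrite mxE.
    rewrite fl; case: existsP => [[i1 dPix]|_]; last exact: f0g0.
    (* A column with 1-entries in both halves can only be the shared one. *)
    have xy0 : x = y0.
      apply/eqP; apply: contraT => /sep[/(_ i0)|/(_ i1)]; first by rewrite uPix.
      by rewrite dPix.
    by move: uPix; rewrite xy0 -g01; apply: f0g0.
  + have dPix : dsubmx P i0 x by rewrite mxE.
    by rewrite fr; case: existsP => [_|[]]; [apply: f1g1 | exists i0].
Qed.

(* Say the column [y] is not needed by the lower half of [P]. The upper half is
   embedded at [(r, c)] inside the [u i]-group of [r]; pruning gives a row
   spanning [T] in the shared column [y0] but in a later [u i]-group of the same
   [u i.+1]-group, and the lower half is embedded there. *)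
Lemma embed E i l (P : 'M[bool]_(l, k)) :
  is_class i P -> i <= s ->
  forall a r T y c, (r, c) \in chain E (a + l) -> blk c = T y ->
    spans (chain E (a + l)) r T ->
  exists f g, copy (chain E a.+1) T (u i) r P f g /\ g y = c.
Proof.
elim=> {i l P} [i P|i la lb P sepP _ IHu _ IHd] i_s a r T y c rcE cT sp.
  (* A single row is placed on [r] itself: each block of [T] offers a column, and [c] is taken for
     [y]. *)
  rewrite addn1 in rcE sp.
  have /fin_all_exists[g gP] : forall x, exists c',
      [/\ (r, c') \in chain E a.+1, blk c' = T x & x == y -> c' = c].
    move=> x; have [->|_] := eqVneq x y; first by exists c.
    by have /existsP[c' /andP[? /eqP ?]] := forallP sp x; exists c'.
  exists (fun=> r), g; split; last by have [_ _ ->] := gP y.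
  split=> //.
  - by move=> [[|//] ?] [[|//] ?].
  - by move=> x; have [rg gx _] := gP x; split=> //; exists r.
  - by move=> _ x _; have [] := gP x.
have [y0 sep] := separationP y sepP.
have nest := grp_mono (umono i).
case: (boolP ((y == y0) || [forall x, ~~ dsubmx P x y])) => yP.
  (* Budget of pruning rounds: the upper half uses [la - 1] of them and the passage to [r1] one
     more, which leaves [a + lb] for the lower half. *)
  rewrite [la + lb]addnC addnA in rcE sp.
  have [f0 [g0 [copy0 g0y]]] := IHu (ltnW i_s) (a + lb) r T y c rcE cT sp.
  have [_ _ /(_ y0)[g0T [r' [r'r r'E r'sp]]] _] := copy0.
  have r'sp' := spansS (chainS E (leqnSn _)) r'sp.
  have [_ [r1 [r1E r1sp r1g r1lt]]] := prune_between (Ordinal i_s) r'E r'sp'.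
  have [f1 [g1 [copy1 g1y0]]] := IHd (ltnW i_s) a r1 T y0 _ r1E g0T r1sp.
  have [|||f [g [fg [gy _]]]] := merge_copies (umono i) (erefl (grp _ r)) _ _
    (copyS (chainS E _) copy0) copy1 (esym g1y0) sep y.
  - by rewrite r1g; apply: nest.
  - by rewrite -r'r.
  - by rewrite ltnS leq_addr.
  by exists f, g; rewrite gy.
have yP' : (y == y0) || [exists x, dsubmx P x y].
  move: yP; rewrite negb_or => /andP[_]; rewrite negb_forall => /existsP[x].
  by rewrite negbK => Pxy; apply/orP; right; apply/existsP; exists x.
(* The mirror case: the lower half comes first, and pruning supplies an earlier group for the upper
   half. *)
rewrite addnA in rcE sp.
have [f1 [g1 [copy1 g1y]]] := IHd (ltnW i_s) (a + la) r T y c rcE cT sp.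
have [_ _ /(_ y0)[g1T [r' [r'r r'E r'sp]]] _] := copy1.
have r'sp' := spansS (chainS E (leqnSn _)) r'sp.
have [[r0 [r0E r0sp r0g r0lt]] _] := prune_between (Ordinal i_s) r'E r'sp'.
have [f0 [g0 [copy0 g0y0]]] := IHu (ltnW i_s) a r0 T y0 _ r0E g1T r0sp.
have [|||f [g [fg [_ gy]]]] := merge_copies (umono i) _ (erefl (grp _ r)) _
  copy0 (copyS (chainS E _) copy1) g0y0 sep y.
- by rewrite r0g; apply: nest.
- by rewrite -r'r.
- by rewrite ltnS leq_addr.
by exists f, g; rewrite gy.
Qed.

End Pruning.

(** * Reduction to rows that meet fewer than [k] blocks *)

Definition avoids (n l k : nat) (E : {set 'I_n * 'I_n}) (P : 'M[bool]_(l, k)) : Prop :=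
  forall (f : 'I_l -> 'I_n) (g : 'I_k -> 'I_n),
    (forall i i' : 'I_l, i < i' -> f i < f i') ->
    (forall j j' : 'I_k, j < j' -> g j < g j') ->
    ~ (forall i j, P i j -> (f i, g j) \in E).

Lemma avoidsS (n l k : nat) (E F : {set 'I_n * 'I_n}) (P : 'M[bool]_(l, k)) :
  E \subset F -> avoids F P -> avoids E P.
Proof.
by move=> EF fr f g finc ginc fg; apply: (fr f g) => // i j /fg; apply: (subsetP EF).
Qed.

Lemma is_class_gt0 (k s l : nat) (P : 'M[bool]_(l, k)) : is_class s P -> 0 < l.
Proof. by elim=> // {}s a b {}P _ _ a0 _ _; rewrite addn_gt0 a0. Qed.

Definition met_blocks (n m : nat) (blk : 'I_n -> 'I_m) (E : {set 'I_n * 'I_n})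
    (r : 'I_n) : {set 'I_m} :=
  [set x | [exists c, ((r, c) \in E) && (blk c == x)]].

(** A row meeting [k] blocks spans an increasing [T], and [embed] then yields a copy of [P] with
    column [j] in block [T j]. The supporting rows recorded in [copy] show that every [g j] is a
    column of [E], so [blkmono] puts the columns in order. *)
Lemma few_blocks (n m k l s : nat) (blk : 'I_n -> 'I_m) (u : nat -> nat)
    (E : {set 'I_n * 'I_n}) (P : 'M[bool]_(l, k)) (r : 'I_n) :
  0 < k -> is_class s P -> avoids E P -> (forall j, u j <= u j.+1) ->
  {in E &, forall e e', blk e.2 < blk e'.2 -> e.2 < e'.2} ->
  #|met_blocks blk (chain k blk u s E l) r| < k.
Proof.
case: k P => // k P _ clP fr umono blkmono; rewrite ltnNge; apply/negP.
move=> /exists_increasing_ffun[T [Tinc Tmet]].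
have sp : spans blk (chain k.+1 blk u s E l) r T.
  by apply/forallP=> x; have := Tmet x; rewrite inE.
have /existsP[c /andP[rcE /eqP cT]] := forallP sp ord0.
have [f [g [[finc _ gsup fg] _]]] := embed umono clP (leqnn s) (a := 0) rcE cT sp.
have subE := chainS k.+1 blk u s E (leq0n 1).
apply: (fr f g) => // [j j' jj'|i j /fg]; last exact: (subsetP subE).
have [gj [r1 [_ r1E _]]] := gsup j; have [gj' [r2 [_ r2E _]]] := gsup j'.
apply: (blkmono (r1, g j) (r2, g j')); rewrite ?(subsetP subE) //=.
by rewrite gj gj' Tinc.
Qed.

(** Homogenization costs a factor [L.+1 ^ s]. [K] is chosen so large that, even after multiplication
    by this factor, the [l] rounds of pruning at the [s] lower scales lose at most half of [E]; this
    half is absorbed on the left. The loss at the top scale is charged to the columns. *)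
Lemma thin_out (n m k l s L : nat) (blk : 'I_n -> 'I_m) (E : {set 'I_n * 'I_n})
    (P : 'M[bool]_(l, k)) (K := 4 * l * s.+1 * m ^ k * L.+1 ^ s) :
  0 < m -> 0 < k -> n <= 2 ^ L -> is_class s.+1 P -> avoids E P ->
  {in E &, forall e e', blk e.2 < blk e'.2 -> e.2 < e'.2} ->
  exists F : {set 'I_n * 'I_n},
    [/\ F \subset E, forall r, #|met_blocks blk F r| < k &
        #|E| <= 2 * (2 * K) ^ s.+1 * cols E + 2 * L.+1 ^ s * #|F|].
Proof.
move=> m0 k0 nL clP fr blkmono.
have l0 := is_class_gt0 clP.
have K0 : 0 < K by rewrite /K !muln_gt0 !expn_gt0 m0 l0.
have [u [F [FE umono small cells cardE]]] := homogenize E s nL K0.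
(* The scale appended above [u s] exceeds [L], or equals it, so its cells are whole columns. *)
pose v j := if j <= s then u j else u s + L.
have vmono j : v j <= v j.+1.
  rewrite /v; case: (ltngtP j s) => [js|//|->]; first exact: umono.
  by rewrite leq_addr.
exists (chain k blk v s.+1 F l); split.
- exact: subset_trans (chainS _ _ _ _ F (leq0n l)) FE.
- move=> r; apply: (few_blocks r k0 clP (avoidsS FE fr) vmono).
  by move=> e e' eF e'F; apply: blkmono; apply: (subsetP FE).
have smallv j y : j < s.+1 ->
    #|[set e in F | cell (v j) e == y]| <= 2 * (2 * K) ^ j.
  by rewrite ltnS /v => js; rewrite js; apply: small.
have := card_chain k blk l smallv; set Fl := chain _ _ _ _ _ _.
rewrite big_ord_recr /=.
set S := \sum_(j < s) _; set top := 2 * (#|cell (v s.+1) @: F| * _) => cardF.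
have S_le : K * S <= 2 * s * #|E|.
  rewrite /S big_distrr /=; apply: (@leq_trans (\sum_(j < s) 2 * #|E|)).
    apply: leq_sum => j _; have := cells j (ltn_ord j).
    rewrite /v ltn_ord expnS.
    move: #|cell (u j.+1) @: F| ((2 * K) ^ j) #|E| (K) => x y e z; lia.
  by rewrite sum_nat_const card_ord mulnCA mulnA.
have top_le : top <= 4 * (2 * K) ^ s * cols E.
  have : #|cell (v s.+1) @: F| <= cols E.
    rewrite /v ltnn; apply: leq_trans (card_cell_large _ nL (leq_addl _ _)) _.
    by rewrite subset_leq_card // imsetS.
  by rewrite /top => /leq_mul/(_ (leqnn (4 * (2 * K) ^ s)));
    move: (_ ^ s) #|cell (v s.+1) @: F| (cols E) => x y z; lia.
move: cardE cardF S_le top_le; rewrite expnMn [(2 * K) ^ s.+1]expnS.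
set W := L.+1 ^ s; set Z := (2 * K) ^ s; rewrite /K -/W; set M := m ^ k.
move: (cols E) (#|E|) (#|F|) (#|Fl|) => c e f fl.
have M0 : 0 < M by rewrite expn_gt0 m0.
have W0 : 0 < W by rewrite expn_gt0.
clearbody S top W Z M; move=> h1 h2 h3 h4.
(* The losses below the top scale, over all [l] rounds, amount to at most half of [E]. *)
have h5 : 2 * W * (l * M * S) <= e.
  rewrite -(@leq_pmul2l (2 * l * M * s.+1)) ?muln_gt0 ?l0 ?M0 //.
  have := leq_mul (leqnn (l * M)) h3; have := leq0n (l * M * e); lia.
have h6 : W * f <= W * fl + W * (l * M * S) + W * (l * M * (4 * Z * c)).
  rewrite -!mulnDr leq_mul2l; apply/orP; right; apply: leq_trans h2 _.
  rewrite -addnA leq_add2l mulnA mulnDr leq_add2l.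
  by rewrite leq_mul2l h4 orbT.
have h7 : (2 * s + 8 * l * M) * W <= 4 * (4 * l * s.+1 * M * W).
  have lM : 1 <= l * M by rewrite muln_gt0 l0.
  have := leq_mul (leqnn (s * W)) lM; have := leq0n (l * M * W).
  have := leq0n (s * l * M * W); lia.
have h8 : (2 * s + 8 * l * M) * W * (Z * c) <= 4 * (4 * l * s.+1 * M * W) * (Z * c).
  by rewrite leq_mul2r h7 orbT.
lia.
Qed.

(** * Recursion over blocks of columns *)

Lemma sum_cols (n m : nat) (blk : 'I_n -> 'I_m) (F : {set 'I_n * 'I_n}) :
  \sum_x cols [set e in F | blk e.2 == x] <= cols F.
Proof.
rewrite [leqRHS](card_fibers blk); apply: leq_sum => x _.
apply: subset_leq_card; apply/subsetP=> c /imsetP[e + ->]; rewrite !inE.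
by move=> /andP[eF ->]; rewrite andbT imset_f.
Qed.

Lemma sum_rows (n m k : nat) (blk : 'I_n -> 'I_m) (F : {set 'I_n * 'I_n}) :
  (forall r, #|met_blocks blk F r| <= k) ->
  \sum_x rows [set e in F | blk e.2 == x] <= k * rows F.
Proof.
move=> few.
apply: (@leq_trans
    (\sum_x \sum_(r in fst @: F) if x \in met_blocks blk F r then 1 else 0)).
  apply: leq_sum => x _; rewrite -big_mkcondr sum1dep_card.
  apply: subset_leq_card; apply/subsetP=> r /imsetP[e + ->]; rewrite !inE.
  move=> /andP[eF ex]; rewrite imset_f //=; apply/existsP; exists e.2.
  by rewrite -surjective_pairing eF.
rewrite exchange_big mulnC -sum_nat_const; apply: leq_sum => r _.
by rewrite -big_mkcond sum1_card.
Qed.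

(** This is [(2 * K) ^ s.+1] for the [K] of [thin_out]. *)
Definition column_cost (s l k m L : nat) : nat :=
  (2 * (4 * l * s.+1 * m ^ k * L.+1 ^ s)) ^ s.+1.

(** Induction on [t], where [E] occupies one column interval of width [m ^ t]. After [thin_out] the
    [m] subintervals are treated separately: their column sets are disjoint, while a row is counted
    fewer than [k] times. In [B], one half of the 4 is the factor of [thin_out], the rest absorbs
    its column term. *)
Lemma block_bound (n m k l s L : nat) (P : 'M[bool]_(l, k)) :
  0 < m -> 0 < k -> n <= 2 ^ L -> is_class s.+1 P ->
  forall t (E : {set 'I_n * 'I_n}), avoids E P ->
  {in E &, forall e e' : 'I_n * 'I_n, e.2 %/ m ^ t = e'.2 %/ m ^ t} ->
  #|E| <= column_cost s l k m L * (4 * k * L.+1 ^ s) ^ t * (rows E + cols E).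
Proof.
move=> m0 k0 nL clP.
set Q := column_cost _ _ _ _ _; set B := 4 * _ * _.
have l0 := is_class_gt0 clP.
have W0 : 0 < L.+1 ^ s by rewrite expn_gt0.
have Q0 : 0 < Q by rewrite /Q /column_cost expn_gt0 !muln_gt0 !expn_gt0 m0 l0.
elim=> [|t IHt] E fr Et.
  rewrite muln1; apply: leq_trans (leq_pmull _ Q0); apply: leq_trans (leq_addr _ _).
  rewrite /rows card_in_imset // => -[r c] [r' c'] /Et h /h /=.
  by rewrite !divn1 => cc ->; congr pair; apply: val_inj.
(* The next base-[m] digit of the column. All columns of [E] agree in the higher digits, so
   comparing this digit orders them. *)
pose blk (c : 'I_n) : 'I_m := Ordinal (ltn_pmod (c %/ m ^ t) m0).
have eq_div : {in E &, forall e e' : 'I_n * 'I_n,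
    e.2 %/ m ^ t %/ m = e'.2 %/ m ^ t %/ m}.
  by move=> e e' eE e'E; rewrite -!divnMA -expnSr; apply: Et.
have blkmono : {in E &, forall e e', blk e.2 < blk e'.2 -> e.2 < e'.2}.
  move=> e e' eE e'E /= lt_blk; rewrite ltnNge; apply: contraL lt_blk => le_e.
  rewrite -leqNgt -(leq_add2l (e.2 %/ m ^ t %/ m * m)) -divn_eq.
  by rewrite (eq_div _ _ eE e'E) -divn_eq leq_div2r.
have [F [FE few cardE]] := thin_out m0 k0 nL clP fr blkmono.
pose Fx x := [set e in F | blk e.2 == x].
set X := Q * B ^ t in IHt *.
have cardFx x : #|Fx x| <= X * (rows (Fx x) + cols (Fx x)).
  have FxF : Fx x \subset F by apply/subsetP=> e; rewrite inE => /andP[].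
  apply: IHt; first exact: avoidsS (subset_trans FxF FE) fr.
  move=> e e'; rewrite !inE => /andP[eF /eqP ex] /andP[e'F /eqP e'x].
  rewrite (divn_eq (e.2 %/ m ^ t) m) (divn_eq (e'.2 %/ m ^ t) m).
  rewrite (eq_div e e') ?(subsetP FE) //; congr addn.
  exact: (congr1 val (etrans ex (esym e'x))).
have cardF : #|F| <= X * (k * rows E + cols E).
  rewrite (card_fibers (fun e => blk e.2)).
  apply: (@leq_trans (\sum_x X * (rows (Fx x) + cols (Fx x)))).
    by apply: leq_sum => x _; apply: cardFx.
  rewrite -big_distrr leq_mul2l big_split; apply/orP; right; apply: leq_add.
    apply: leq_trans (sum_rows (k := k) _) _; first by move=> r; apply: ltnW.
    by rewrite leq_mul2l subset_leq_card ?orbT // imsetS.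
  apply: leq_trans (sum_cols _ _) _.
  by rewrite subset_leq_card // imsetS.
rewrite expnSr mulnA -/X; apply: leq_trans cardE _.
rewrite -/(column_cost s l k m L) -/Q.
have QX : Q <= X by rewrite leq_pmulr // expn_gt0 /B !muln_gt0 k0 W0.
clearbody X Q; rewrite {}/B.
move: (L.+1 ^ s) W0 (rows E) (cols E) #|F| cardF => W W0 p q f cardF.
have h1 : 2 * W * f <= 2 * W * (X * (k * p + q)) by rewrite leq_mul2l cardF orbT.
have h2 : 2 * Q * q <= 2 * (W * X) * q.
  by rewrite leq_mul2r leq_mul2l (leq_trans QX) ?orbT // leq_pmull.
have h3 : 4 * (W * X) * q <= 4 * k * (W * X) * q.
  by rewrite !leq_mul2r leq_pmulr ?orbT.
have := leq0n (W * X * k * p); lia.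
Qed.

(** * Bounds on [ex] with integer exponents *)

Lemma ex_leq (n l k b : nat) (P : 'M[bool]_(l, k)) :
  (forall E : {set 'I_n * 'I_n}, avoids E P -> #|E| <= b) -> ex n P <= b.
Proof.
move=> bound; apply/bigmax_leqP => A nA; apply: bound => f g finc ginc fg.
move: nA => /negP; apply; apply/boolp.asboolP; exists f, g; split=> // i j /fg.
by rewrite inE.
Qed.

Lemma ex_leq_square (n l k : nat) (P : 'M[bool]_(l, k)) : ex n P <= n * n.
Proof.
apply: ex_leq => E _; apply: leq_trans (max_card _) _.
by rewrite card_prod card_ord.
Qed.

Lemma is_class0_rows (k l : nat) (P : 'M[bool]_(l, k)) : is_class 0 P -> l = 1.
Proof.
move=> clP; have : 0 = 0 by [].
by move: {1 3}0 clP => s clP; case: clP.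
Qed.

Lemma ex_class0 (n l k : nat) (P : 'M[bool]_(l, k)) :
  is_class 0 P -> ex n P <= n * k.
Proof.
move=> /is_class0_rows l1; move: P; rewrite l1 {l l1} => P.
apply: ex_leq => E fr; rewrite (card_fibers fst).
apply: (@leq_trans (\sum_(r < n) k)); last by rewrite sum_nat_const card_ord.
apply: leq_sum => r _; set H := [set _ in E | _].
have -> : #|H| = #|snd @: H|.
  rewrite card_in_imset // => -[a c] [a' c']; rewrite !inE /=.
  by move=> /andP[_ /eqP ->] /andP[_ /eqP ->] ->.
case: (leqP k #|snd @: H|) => [|/ltnW //] /exists_increasing_ffun[T [Tinc TH]].
case: (fr (fun=> r) T) => // [[[|//] ?] [[|//] ?] //|_ j _].
have /imsetP[e + ->] := TH j; rewrite inE => /andP[eE /eqP <-].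
by rewrite -surjective_pairing.
Qed.

Lemma leq_self_exp2 (a : nat) : a <= 2 ^ a.
Proof. exact: ltnW (ltn_expl a (isT : 1 < 2)). Qed.

(** As [z <= 2 ^ z], the left side is [2 ^ O(z)]. The exponent [z ^ s] is small enough for the bound
    to remain [2 ^ O(z ^ s.+1)] after being raised to the recursion depth [z]. *)
Lemma polylog_bound (s z : nat) : 0 < z ->
  (z ^ s.+2).+1 ^ s <= 2 ^ (s * (s + 3) * z ^ s).
Proof.
case: s => [|s] z0 //.
have le1 : (z ^ s.+3).+1 <= 2 ^ ((s.+1 + 3) * z).
  apply: (@leq_trans (2 * z ^ s.+3)).
    by rewrite mul2n -addnn -add1n leq_add2r expn_gt0 z0.
  apply: (@leq_trans (2 ^ z * (2 ^ z) ^ s.+3)).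
    apply: leq_mul; first by rewrite -[X in X <= _]expn1 leq_exp2l.
    by rewrite leq_exp2r // leq_self_exp2.
  by rewrite -expnM -expnD leq_exp2l //; lia.
apply: (@leq_trans ((2 ^ ((s.+1 + 3) * z)) ^ s.+1)); first by rewrite leq_exp2r.
rewrite -expnM leq_exp2l // mulnC mulnA leq_mul2l.
by rewrite expnS leq_pmulr ?orbT // expn_gt0 z0.
Qed.

(* The recursion is run with [m = 2 ^ z ^ s] blocks, to depth [z]. *)
Lemma ex_class_bound (l k s : nat) (P : 'M[bool]_(l, k)) :
  0 < k -> is_class s P ->
  exists C : nat, forall z n : nat, 0 < z -> n <= 2 ^ (z ^ s.+1) ->
    ex n P <= n * 2 ^ (C * z ^ s).
Proof.
case: s => [|s] k0 clP.
  exists k => z n _ _; apply: leq_trans (ex_class0 _ clP) _.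
  by rewrite muln1 leq_mul2l leq_self_exp2 orbT.
have l0 := is_class_gt0 clP.
pose a := s * (s + 3).
(* [C1] pays for the column cost and [C2] for the [z] levels of recursion; the additional 1 covers
   [rows E + cols E <= n * 2]. *)
pose C1 := s.+1 * (8 * l * s.+1 + k + a); pose C2 := 4 * k + a.
exists (1 + C1 + C2) => z n z0 nz.
set L := z ^ s.+2; set Z := z ^ s.+1.
have zs0 : 0 < z ^ s by rewrite expn_gt0 z0.
have sZ : z ^ s <= Z by rewrite /Z expnS leq_pmull.
have zZ : z <= Z by rewrite /Z expnS leq_pmulr.
have Z0 : 0 < Z by apply: leq_trans zZ.
have W_le : L.+1 ^ s <= 2 ^ (a * z ^ s) by apply: polylog_bound.
have W_leZ : L.+1 ^ s <= 2 ^ (a * Z).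
  by apply: leq_trans W_le _; rewrite leq_exp2l // leq_mul2l sZ orbT.
have m0 : 0 < 2 ^ Z by rewrite expn_gt0.
have Q_le : column_cost s l k (2 ^ Z) L <= 2 ^ (C1 * Z).
  have -> : C1 * Z = (8 * l * s.+1 + k + a) * Z * s.+1.
    by rewrite /C1 -mulnA mulnC.
  rewrite (expnM 2 _ s.+1) leq_exp2r // (mulnDl _ a) (mulnDl _ k) 2!expnD.
  rewrite [k * Z]mulnC [2 ^ (Z * k)]expnM.
  rewrite !(mulnA 2).
  apply: leq_mul W_leZ; apply: leq_mul (leqnn _).
  by apply: leq_trans (leq_self_exp2 _) _; rewrite leq_exp2l // leq_pmulr.
have B_le : (4 * k * L.+1 ^ s) ^ z <= 2 ^ (C2 * Z).
  apply: (@leq_trans ((2 ^ (C2 * z ^ s)) ^ z)).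
    rewrite leq_exp2r // (mulnDl _ a) expnD; apply: leq_mul W_le.
    by apply: leq_trans (leq_self_exp2 _) _; rewrite leq_exp2l // leq_pmulr.
  by rewrite -expnM -mulnA -expnSr.
apply: ex_leq => E fr.
(* Here [m ^ z = 2 ^ L] is at least [n], so at depth [z] all columns form a single interval. *)
have Ez : {in E &, forall e e' : 'I_n * 'I_n, e.2 %/ (2 ^ Z) ^ z = e'.2 %/ (2 ^ Z) ^ z}.
  move=> e e' _ _; rewrite -expnM -expnSr.
  by rewrite !divn_small // (leq_trans (ltn_ord _) nz).
apply: leq_trans (block_bound m0 k0 nz clP fr Ez) _.
have rc : rows E + cols E <= n * 2.
  rewrite muln2 -addnn; apply: leq_add; apply: leq_trans (max_card _) _;
  by rewrite card_ord.
apply: leq_trans (leq_mul (leq_mul Q_le B_le) rc) _.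
rewrite [leqLHS]mulnC -mulnA leq_mul2l (mulnDl _ C2) (mulnDl 1 C1) mul1n 2!expnD.
apply/orP; right.
rewrite -mulnA; apply: leq_mul (leqnn _).
by rewrite -[X in X <= _]expn1 leq_exp2l.
Qed.

(** * The real exponent *)

From mathcomp Require Import all_classical all_reals all_analysis lra.

Import Order.TTheory GRing.Theory Num.Theory.

Local Open Scope ring_scope.

Lemma powR2_log2 (R : realType) (n : nat) :
  (0 < n)%N -> 2 `^ log2 (n%:R : R) = n%:R.
Proof.
move=> n0; have ln2 : ln (2 : R) != 0 by rewrite gt_eqF // ln_gt0 // ltr1n.
rewrite /powR pnatr_eq0 /= /log2 divfK //.
by rewrite lnK // posrE ltr0n.
Qed.

Lemma powR2_ge1 (R : realType) (x : R) : 0 <= x -> 1 <= 2 `^ x.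
Proof.
by move=> x0; rewrite -[leLHS](powRr0 (2 : R)) ler_powR // ler1n.
Qed.

(** Take [z] to be the integer part of [y], the root of [x] of order [s.+1], plus one. As [y >= 1],
    this is at most [2 * y], whence the factor [2 ^ s]. *)
Lemma pow_root_cover (R : realType) (x : R) (s : nat) : 1 <= x ->
  exists z : nat, [/\ (0 < z)%N, x <= (z ^ s.+1)%:R &
    (z ^ s)%:R <= (2 ^ s)%:R * x `^ (s%:R / s.+1%:R)].
Proof.
move=> x1; have x0 : 0 <= x by lra.
pose y := x `^ (s.+1%:R^-1).
have y1 : 1 <= y by rewrite -[leLHS](powRr0 x) ler_powR // invr_ge0.
have y0 : 0 <= y by lra.
have yX m : y ^+ m = x `^ (m%:R / s.+1%:R).
  by rewrite -powR_mulrn // /y -powRrM mulrC.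
exists (Num.truncn y).+1; split=> //.
- have {1}-> : x = y ^+ s.+1 by rewrite yX divff ?pnatr_eq0 // powRr1.
  by rewrite natrX lerXn2r ?nnegrE ?ler0n // ltW // truncnS_gt.
- rewrite !natrX -yX -exprMn lerXn2r ?nnegrE ?ler0n ?mulr_ge0 //.
  have : (Num.truncn y)%:R <= y by rewrite truncn_le.
  rewrite -natr1; lra.
Qed.

Theorem theorem2 (R : realType) (l k : nat) (P : 'M[bool]_(l, k))
    (hP : exists (i : 'I_l) (j : 'I_k), P i j) :
  exists C : R, forall s : nat, is_class s P ->
    forall n : nat, (0 < n)%N ->
      (ex n P)%:R <= n%:R * 2 `^ (C * log2 (n%:R : R) `^ (s%:R / s.+1%:R)).
Proof.
have k0 : (0 < k)%N by case: hP => _ [j _]; apply: leq_ltn_trans (ltn_ord j).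
(* [C] must not depend on [s], so it is taken from the least [s0] for which [P] is class-[s0]; for
   larger [s] the exponent [s / (s + 1)] only grows. *)
case: (pselect (exists s, `[< is_class s P >])) => [ex_s|no_s]; last first.
  by exists 0 => s clP; case: no_s; exists s; apply/asboolP.
case: (ex_minnP ex_s) => s0 /asboolP clP0 min_s0.
have [C0 bound] := ex_class_bound k0 clP0.
exists (C0 * 2 ^ s0)%:R => s clP n n0.
have s0s : (s0 <= s)%N by apply/min_s0/asboolP.
(* Monotonicity in the exponent needs [log2 n >= 1]; for [n = 1] the trivial bound [n * n]
   suffices. *)
case: (ltngtP n 1) => [|n_gt1|->]; first by case: n n0.
  have x1 : 1 <= log2 (n%:R : R).
    rewrite /log2 ler_pdivlMr ?ln_gt0 ?ltr1n // mul1r ler_ln ?posrE ?ltr0n //.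
    by rewrite ler_nat.
  have nE := powR2_log2 R n0.
  move: (log2 _) x1 nE => x x1 nE.
  have [z [z0 xz zx]] := pow_root_cover s0 x1.
  have nz : (n <= 2 ^ (z ^ s0.+1))%N.
    rewrite -(ler_nat R) -nE natrX -powR_mulrn //.
    by rewrite ler_powR // ler1n.
  apply: (@le_trans _ _ (n * 2 ^ (C0 * z ^ s0))%:R).
    by rewrite ler_nat; apply: bound.
  rewrite natrM ler_wpM2l // natrX -powR_mulrn // ler_powR ?ler1n //.
  rewrite !natrM -mulrA ler_wpM2l //; apply: le_trans zx _.
  rewrite ler_wpM2l // ler_powR //.
  rewrite ler_pdivrMr ?ltr0n // mulrAC ler_pdivlMr ?ltr0n // -!natrM ler_nat.
  by lia.
rewrite mul1r; apply: (@le_trans _ _ 1).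
  by rewrite (ler_nat R _ 1); apply: ex_leq_square.
by rewrite powR2_ge1 // mulr_ge0 // powR_ge0.
Qed.
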